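(* Let $I\subseteq\mathbb{C}[x_1,\ldots,x_n]$ be a homogeneous prime ideal and let $\mathfrak{g}_I$ be its symmetry Lie algebra. If $\dim(\mathfrak{g}_I)<\dim(I)$, then $V(I)$ is not a toric variety.
   Context: Let $R=\mathbb{C}[x_1,\ldots,x_n]$. $\dim(I)$ denotes the Krull dimension of $R/I$, i.e. the dimension of the affine variety $V(I)\subseteq\mathbb{C}^n$ of common zeros of $I$. The group $\mathrm{GL}_n(\mathbb{C})$ acts on $R$ by $(g\cdot p)(x)=p(g^{-1}x)$, $x=(x_1,\ldots,x_n)^T$. The symmetry Lie group of $I$ is $G_I=\{g\in\mathrm{GL}_n(\mathbb{C})\mid g\cdot p\in I\ \text{for all } p\in I\}$, a closed subgroup of $\mathrm{GL}_n(\mathbb{C})$, and the symmetry Lie algebra of $I$ is its Lie algebra $\mathfrak{g}_I=\{g\in M_n(\mathbb{C})\mid e^{tg}\in G_I\ \text{for all } t\in\mathbb{R}\}$. It is a complex Lie algebra and $\dim(\mathfrak{g}_I)$ is its dimension as a complex vector space. Toric variety: let $\mathcal{A}=\{\mathbf{a}_1,\ldots,\mathbf{a}_n\}\subseteq\mathbb{Z}^r$ be a finite subset, where $\mathbf{a}_i=(a_{1i},\ldots,a_{ri})$, and let $\chi^{\mathbf{a}_i}(\mathbf{t})=t_1^{a_{1i}}\cdots t_r^{a_{ri}}$ be the corresponding characters of the torus $\mathbb{T}_r=(\mathbb{C}\setminus\{0\})^r$. Define $\Phi_{\mathcal{A}}:\mathbb{T}_r\to(\mathbb{C}\setminus\{0\})^n$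 by $\Phi_{\mathcal{A}}(\mathbf{t})=(\chi^{\mathbf{a}_1}(\mathbf{t}),\ldots,\chi^{\mathbf{a}_n}(\mathbf{t}))$. An affine variety $V\subseteq\mathbb{C}^n$ is a toric variety if it is the Zariski closure in $\mathbb{C}^n$ of the image of $\Phi_{\mathcal{A}}$ for some $r$ and some such $\mathcal{A}$. *)

(* Defs.v *)
(* The field of complex numbers is R[i], for R : realType. *)
From HB Require Import structures.
From mathcomp Require Import all_boot all_order all_algebra.
From mathcomp Require Import -(notations) mpoly.
From mathcomp Require Import complex.
From mathcomp Require Import boolp classical_sets.
From mathcomp Require Import reals ereal topology normedtype sequences.

Set Implicit Arguments.
Unset Strict Implicit.
Unset Printing Implicit Defensive.

Import Order.TTheory GRing.Theory Num.Theory numFieldNormedType.Exports.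

Local Open Scope classical_set_scope.
Local Open Scope ring_scope.
Local Open Scope complex_scope.

Section Dimensions.

Definition strict_chain (A : nzRingType) (d : nat)
    (P : 'I_d.+1 -> prime_idealr A) : Prop :=
  forall i j : 'I_d.+1, (i < j)%N ->
    {subset P i <= P j} /\ ~ {subset P j <= P i}.

(* The supremum of the lengths of chains of prime ideals; a chain with d + 1
   members has length d.  Classically the boolean predicates of prime_idealr
   are arbitrary prime ideals. *)
Definition krull_dim (R : realType) (A : comNzRingType) : \bar R :=
  ereal_sup [set (d%:R)%:E | d in
    [set d : nat | exists P : 'I_d.+1 -> prime_idealr A, strict_chain P]].

(* The largest size of a linearly independent family in S; it is the dimension
   of S when S is a linear subspace, see linear_dimE. *)
Definition linear_dim (F : fieldType) (V : vectType F) (S : set V) : nat :=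
  \max_(k < (\dim {:V}).+1 |
    `[< exists X : k.-tuple V, free X /\ (forall v, v \in X -> S v) >]) k.

Lemma linear_dimE (F : fieldType) (V : vectType F) (U : {vspace V}) :
  linear_dim [set` U] = \dim U.
Proof.
apply/eqP; rewrite eqn_leq; apply/andP; split.
  apply/bigmax_leqP => k /asboolP[X [Xfree XU]].
  rewrite -[leqLHS](size_tuple X) -(eqP Xfree); apply: dimvS.
  by apply/span_subvP => v /XU.
have ltU : (\dim U < (\dim {:V}).+1)%N by rewrite ltnS dimvS ?subvf.
apply: (@leq_bigmax_cond _ _ (fun k : 'I__ => k : nat) (Ordinal ltU)).
apply/asboolP; exists (vbasis U); split; first exact: basis_free (vbasisP U).
by move=> v; exact: vbasis_mem.
Qed.

End Dimensions.

Section SymmetryAlgebra.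
Variables (R : realType) (n : nat).
Local Notation C := R[i].
Implicit Types (x : 'cV[C]_n) (p : mpoly n C) (g : 'M[C]_n) (I : {pred mpoly n C}).

Definition peval x p : C := meval (fun i => x i 0) p.

Definition homogeneous_ideal I : Prop :=
  forall p, p \in I -> forall d : nat, pihomog mdeg d p \in I.

(* g.p = p (g^-1 x), obtained by substituting the i-th coordinate of g^-1 x
   for the i-th variable. *)
Definition gl_act g p : mpoly n C :=
  comp_mpoly [tuple \sum_(j < n) invmx g i j *: mpolyX C (mnm1 j) | i < n] p.

Lemma peval_gl_act g p x : peval x (gl_act g p) = peval (invmx g *m x) p.
Proof.
rewrite /peval /gl_act comp_mpolyE raddf_sum mevalE /=; apply: eq_bigr => m _.
rewrite mevalZ rmorph_prod /=; congr (_ * _); apply: eq_bigr => i _.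
rewrite rmorphXn /= tnth_mktuple raddf_sum mxE /=; congr (_ ^+ _).
by apply: eq_bigr => j _; rewrite mevalZ mevalXU.
Qed.

Definition symmetry_group I : set 'M[C]_n :=
  [set g | g \in unitmx /\ forall p, p \in I -> gl_act g p \in I].

(* C^o is C with its norm topology, whence the entrywise topology on matrices. *)
Definition expmx g : 'M[C]_n :=
  limn (fun N : nat => \sum_(0 <= k < N) (k`!%:R : C)^-1 *: g ^+ k : 'M[C^o]_n).

Definition symmetry_algebra I : set 'M[C]_n :=
  [set g | forall t : R, symmetry_group I (expmx (t%:C *: g))].

End SymmetryAlgebra.

Section ToricVarieties.
Variable R : realType.
Local Notation C := R[i].

Definition zeros (n : nat) (F : set (mpoly n C)) : set 'cV[C]_n :=
  [set x | forall p, F p -> peval x p = 0].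

Definition zariski_closure (n : nat) (S : set 'cV[C]_n) : set 'cV[C]_n :=
  smallest [set Z | exists F : set (mpoly n C), Z = zeros F] S.

Definition torus (r : nat) : set 'cV[C]_r := [set t | forall k, t k 0 != 0].

(* The exponent vectors a_1, ..., a_n are the columns of A; repetitions
   are allowed. *)
Definition torus_map (r n : nat) (A : 'M[int]_(r, n)) (t : 'cV[C]_r) : 'cV[C]_n :=
  \col_(i < n) \prod_(k < r) t k 0 ^ A k i.

Definition toric_variety (n : nat) (V : set 'cV[C]_n) : Prop :=
  exists (r : nat) (A : 'M[int]_(r, n)),
    V = zariski_closure (torus_map A @` @torus r).

End ToricVarieties.

(* Main.v *)
Require Import Defs.
From HB Require Import structures.
From mathcomp Require Import all_boot all_order all_algebra.
From mathcomp Require Import -(notations) mpoly.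
From mathcomp Require Import complex.
From mathcomp Require Import boolp classical_sets.
From mathcomp Require Import cardinality.
From mathcomp Require Import reals ereal topology normedtype sequences.
From mathcomp Require Import exp lebesgue_measure.
From mathcomp Require Import zify ring.

Set Implicit Arguments.
Unset Strict Implicit.
Unset Printing Implicit Defensive.

Import Order.TTheory GRing.Theory Num.Theory numFieldNormedType.Exports.

Local Open Scope classical_set_scope.
Local Open Scope ring_scope.
Local Open Scope complex_scope.

(** Suppose that V(I) is the closure of the image of the monomial map given by
    the integer matrix A, and let d be the rank of A.  Both dimensions are
    compared with d: the Krull dimension of the quotient by I is at most d,
    and the symmetry Lie algebra contains d independent diagonal matrices, so
    the strict inequality is impossible.

    The Nullstellensatz identifies the prime ideal I with the ideal of the
    polynomials that vanish on the image of the torus (toric_idealP).  Its proof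
    uses that the complex numbers are uncountable: if no translate x - a could
    be adjoined to an ideal J while still avoiding the powers of p, uncountably
    many cofactors would live in countably many finite-dimensional spaces, and a
    linear relation between finitely many of them produces a polynomial in x
    that contradicts the choice of p.  Adjoining a translate of each variable in
    turn reaches a point of V(J) where p does not vanish.

    For the upper bound, picking an element in each step of a chain of primes of
    length d' gives d' elements whose monomials are linearly independent in the
    quotient (chain_independence).  On the other hand the d' elements have N^d'
    monomials with exponents below N, and on the torus each of them is a
    combination of characters whose weights lie in a box of side O(N) and are
    determined by d of their coordinates; there are only O(N^d) of these, so
    d' > d would force a linear relation for large N (toric_relation).

    For the lower bound, scaling the k-th torus coordinate by e^t multiplies the
    i-th coordinate of the monomial map by e^(t A k i).  Hence the diagonal
    matrix whose entries are the k-th row of A is in the symmetry algebra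
    (row_symmetry_algebra), and d rows of A are independent. *)

(** * Linear relations and uncountability *)

Lemma nontrivial_relation (F : fieldType) (T U : finType) (phi : T -> U -> F) :
  (#|U| < #|T|)%N ->
  exists2 c : T -> F, (exists t, c t != 0) &
    forall u, \sum_t c t * phi t u = 0.
Proof.
move=> ltUT.
pose M := \matrix_(i < #|T|, j < #|U|) phi (enum_val i) (enum_val j).
have /rowV0Pn[v /sub_kermxP vM /rV0Pn[j vj]] : kermx M != 0.
  rewrite kermx_eq0 /row_free neq_ltn (leq_ltn_trans _ ltUT) //.
  exact: rank_leq_col.
exists (fun t => v 0 (enum_rank t)); first by exists (enum_val j); rewrite enum_valK.
move=> u; move/rowP: vM => /(_ (enum_rank u)); rewrite !mxE => vM0.
rewrite (reindex (@enum_val T T)) -?[RHS]vM0 /=; last first.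
  by exists enum_rank => i _; rewrite ?enum_valK ?enum_rankK.
by apply: eq_bigr => i _; rewrite !mxE enum_valK enum_rankK.
Qed.

(** Pigeonhole: countably many finite fibers have a countable union. *)
Lemma uncountable_fiber (T : choiceType) (f : T -> nat * nat) :
  ~ countable [set: T] ->
  exists i : nat * nat, forall N, exists2 s : 'I_N -> T,
    injective s & forall k, f (s k) = i.
Proof.
move=> Tunc; have [i fi] : exists i, infinite_set (f @^-1` [set i]).
  apply: contrapT => /forallNP Hf; apply: Tunc.
  have -> : [set: T] = \bigcup_(i in [set: nat * nat]) f @^-1` [set i].
    by rewrite eqEsubset; split => // x _; exists (f x).
  apply: bigcup_countable => // i _.
  by apply: finite_set_countable; apply: contrapT; apply: Hf.
exists i => N; have [B Bf leNB] := infinite_set_fset N fi.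
exists (fun k => tnth (in_tuple (finmap.enum_fset B)) (widen_ord leNB k)).
  move=> j k /tuple_uniqP/(congr1 val) /= jk; apply: val_inj.
  by apply: jk; exact: finmap.fset_uniq.
by move=> k; apply: Bf; exact: mem_tnth.
Qed.

(** A countable set of complex numbers has a countable set of real parts, which
    is Lebesgue-negligible, whereas the unit interval is not. *)
Lemma uncountable_complex (R : realType) : ~ countable [set: R[i]].
Proof.
move=> Ccount.
have /countable_lebesgue_measure0 : countable `[(0:R), 1].
  apply: sub_countable _ (sub_countable (card_image_le (@complex.Re R) _) Ccount).
  by apply: subset_card_le => x _; exists x%:C.
rewrite lebesgue_measure_itv /= lte_fin ltr01 oppr0 adde0 => /eqP.
by rewrite eqe oner_eq0.
Qed.

(** * The Nullstellensatz over an uncountable field *)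

Section PropIdeals.
Variable A : comNzRingType.
Implicit Types (J : set A) (a f g p q u v : A).

(** Ideals are arbitrary sets here, possibly the whole ring: adjoining an element
    may produce the unit ideal. *)
Definition prop_ideal J : Prop :=
  J 0 /\ forall a u v, J u -> J v -> J (a * u + v).

Definition avoids_powers J p : Prop := forall k, ~ J (p ^+ k).

Definition adjoin J f : set A := [set q | exists g, J (q - g * f)].

Lemma prop_idealD J u v : prop_ideal J -> J u -> J v -> J (u + v).
Proof. by move=> [_ JD] Ju Jv; rewrite -[u]mul1r; exact: JD. Qed.

Lemma prop_idealM J a u : prop_ideal J -> J u -> J (a * u).
Proof. by move=> [J0 JD] Ju; rewrite -[_ * _]addr0; exact: JD. Qed.

Lemma prop_idealB J u v : prop_ideal J -> J u -> J v -> J (u - v).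
Proof.
move=> JI Ju Jv; apply: prop_idealD => //.
by rewrite -mulN1r; exact: prop_idealM.
Qed.

Lemma prop_ideal_sum J (T : finType) (F : T -> A) :
  prop_ideal J -> (forall t, J (F t)) -> J (\sum_t F t).
Proof.
move=> JI JF; elim/big_rec: _ => [|t x _ Jx]; first by case: JI.
exact: prop_idealD.
Qed.

Lemma adjoin_ideal J f : prop_ideal J -> prop_ideal (adjoin J f).
Proof.
move=> JI; split; first by exists 0; rewrite mul0r subr0; case: JI.
move=> a u v [g Jg] [h Jh]; exists (a * g + h).
rewrite (_ : _ - _ = a * (u - g * f) + (v - h * f)); last by ring.
by case: JI => _; apply.
Qed.

Lemma adjoin_sub J f : J `<=` adjoin J f.
Proof. by move=> u Ju; exists 0; rewrite mul0r subr0. Qed.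

Lemma adjoin_mem J f : prop_ideal J -> adjoin J f f.
Proof. by move=> [J0 _]; exists 1; rewrite mul1r subrr. Qed.

(** If p^k = g f and p^l = h f' modulo J, then p^(k + l) = (g h) (f f') modulo J. *)
Lemma adjoin_prod_powers J p (I : Type) (s : seq I) (f : I -> A) :
  prop_ideal J -> (forall i, exists k, adjoin J (f i) (p ^+ k)) ->
  exists k, adjoin J (\prod_(i <- s) f i) (p ^+ k).
Proof.
move=> JI Jf; elim: s => [|i s [k [g Jg]]].
  by exists 0%N; rewrite big_nil; exact: adjoin_mem.
have [l [h Jh]] := Jf i; exists (l + k)%N; exists (h * g); rewrite big_cons.
set Q := \prod_(_ <- _) _ in Jg *.
rewrite (_ : _ - _ = p ^+ k * (p ^+ l - h * f i) + h * f i * (p ^+ k - g * Q)).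
  by apply: prop_idealD => //; exact: prop_idealM.
by rewrite exprD; ring.
Qed.

End PropIdeals.

Section Nullstellensatz.
Variables (K : closedFieldType) (n : nat).
Hypothesis Kunc : ~ countable [set: K].
Implicit Types (J : set (mpoly n K)) (p x : mpoly n K).

(** Otherwise p^k = g_a (x - a) modulo J for every scalar a, with k and g_a
    depending on a.  For infinitely many a the exponent k and the degree of g_a
    are the same, so the g_a satisfy a linear relation.  Clearing denominators
    in the sum of c_a / (X - a) turns it into a nonzero univariate h such that
    p^k h(x) is in J.  As h is a product of translates X - b, each of which
    divides a power of p modulo J, so does h(x), and then a power of p is in J. *)
Lemma adjoin_translate J p x : prop_ideal J -> avoids_powers J p ->
  exists a : K, avoids_powers (adjoin J (x - a%:A)) p.
Proof.
move=> JI Jp; apply: contrapT => /forallNP Hx.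
have Hp a : exists k, adjoin J (x - a%:A) (p ^+ k).
  by have /existsNP[k /contrapT] := Hx a; exists k.
have [kg Hkg] : {kg : K -> nat * mpoly n K &
    forall a, J (p ^+ (kg a).1 - (kg a).2 * (x - a%:A))}.
  apply: (@boolp.choice _ _ (fun a kg => J (p ^+ kg.1 - kg.2 * (x - a%:A)))) => a.
  by have [k [g Jg]] := Hp a; exists (k, g).
have [[k D] /(_ #|{: bmultinom n D}|.+1)[a a_inj a_fib]] :=
  uncountable_fiber (fun a => ((kg a).1, mmeasure mdeg (kg a).2)) Kunc.
set N := #|{: bmultinom n D}|.+1 in a a_inj a_fib.
pose g t := (kg (a t)).2.
have Hg t : J (p ^+ k - g t * (x - (a t)%:A)).
  by have [<- _] := a_fib t; exact: Hkg.
have [|c [t0 ct0] crel] :=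
    @nontrivial_relation _ 'I_N (bmultinom n D) (fun t m => mcoeff m (g t)).
  by rewrite card_ord.
have sum_cg : \sum_t c t *: g t = 0.
  under eq_bigr => t _.
    rewrite [g t](@mpolywE _ _ D); last by have [_ <-] := a_fib t.
    rewrite scaler_sumr; under eq_bigr do rewrite scalerA.
    over.
  rewrite exchange_big big1 // => m _.
  by rewrite -scaler_suml crel scale0r.
pose h : {poly K} := \sum_t c t *: \prod_(s | s != t) ('X - (a s)%:P).
(* Only the t0-th term of h survives at a t0. *)
have h_neq0 : h != 0.
  apply/eqP => /(congr1 (horner^~ (a t0))); rewrite horner0 horner_sum (bigD1 t0) //=.
  rewrite [X in _ + X]big1 ?addr0 => [|t tt0]; last first.
    rewrite hornerZ horner_prod (bigD1 t0) 1?eq_sym //=.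
    by rewrite hornerXsubC subrr mul0r mulr0.
  apply/eqP; rewrite hornerZ mulf_neq0 // horner_prod; apply/prodf_neq0 => s st0.
  by rewrite hornerXsubC subr_eq0 (inj_eq a_inj) eq_sym.
have hxE : horner_alg x h = \sum_t c t *: \prod_(s | s != t) (x - (a s)%:A).
  rewrite linear_sum /=; apply: eq_bigr => t _; rewrite linearZ rmorph_prod /=.
  by rewrite mulr_algl; congr (_ *: _); apply: eq_bigr => s _;
    rewrite rmorphB /= horner_algX horner_algC.
have Jh : J (p ^+ k * horner_alg x h).
  have -> : p ^+ k * horner_alg x h =
      \sum_t (c t *: \prod_(s | s != t) (x - (a s)%:A)) *
               (p ^+ k - g t * (x - (a t)%:A)).
    under [RHS]eq_bigr do rewrite mulrBr.
    rewrite sumrB -mulr_suml -hxE mulrC.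
    rewrite (_ : \sum_t _ = (\prod_s (x - (a s)%:A)) * \sum_t c t *: g t).
      by rewrite sum_cg mulr0 subr0.
    rewrite mulr_sumr; apply: eq_bigr => t _.
    rewrite [in RHS](bigD1 t) //= -scalerAl -[in RHS]scalerAr.
    by congr (_ *: _); ring.
  by apply: prop_ideal_sum => // t; exact: prop_idealM.
have [bs hE] := closed_field_poly_normal h.
have [l [q Jq]] := adjoin_prod_powers bs JI Hp.
have hxE2 : horner_alg x h = lead_coef h *: \prod_(b <- bs) (x - b%:A).
  rewrite {1}hE linearZ rmorph_prod /=.
  by rewrite mulr_algl; congr (_ *: _); apply: eq_bigr => s _;
    rewrite rmorphB /= horner_algX horner_algC.
set Q := \prod_(b <- bs) _ in Jq hxE2.
have QE : Q = (lead_coef h)^-1 *: horner_alg x h.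
  by rewrite hxE2 scalerA mulVf ?lead_coef_eq0 // scale1r.
apply: (Jp (k + l)%N).
have -> : p ^+ (k + l) = p ^+ k * (p ^+ l - q * Q)
      + ((lead_coef h)^-1%:A * q) * (p ^+ k * horner_alg x h).
  by rewrite QE exprD -mulr_algl; ring.
by apply: prop_idealD => //; exact: prop_idealM.
Qed.

Lemma adjoin_translates J p (s : seq 'I_n) : prop_ideal J -> avoids_powers J p ->
  exists J', [/\ prop_ideal J', J `<=` J', avoids_powers J' p &
    forall i, i \in s -> exists a : K, J' (mpolyX K (mnm1 i) - a%:A)].
Proof.
move=> JI Jp; elim: s => [|i s [J1 [J1I JJ1 J1p J1s]]]; first by exists J; split.
have [a Ja] := adjoin_translate (mpolyX K (mnm1 i)) J1I J1p.
exists (adjoin J1 (mpolyX K (mnm1 i) - a%:A)); split => //.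
- exact: adjoin_ideal.
- by apply: subset_trans JJ1 _; exact: adjoin_sub.
move=> j; rewrite inE => /orP[/eqP -> |/J1s[b J1b]].
  by exists a; exact: adjoin_mem.
by exists b; exact: adjoin_sub.
Qed.

(** Modulo J every variable is a scalar, hence so is every polynomial. *)
Lemma sub_meval_ideal J (a : 'I_n -> K) f : prop_ideal J ->
  (forall i, J (mpolyX K (mnm1 i) - (a i)%:A)) -> J (f - (meval a f)%:A).
Proof.
move=> JI Ja; pose S g := J (g - (meval a g)%:A).
have SC c : S c%:A.
  by rewrite /S alg_mpolyC mevalC alg_mpolyC subrr; case: JI.
have SM g h : S g -> S h -> S (g * h).
  rewrite /S mevalM => Sg Sh; rewrite (_ : _ - _ =
    h * (g - (meval a g)%:A) + (meval a g)%:A * (h - (meval a h)%:A)).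
    by apply: prop_idealD => //; exact: prop_idealM.
  by rewrite !alg_mpolyC mpolyCM; ring.
have SD g h : S g -> S h -> S (g + h).
  rewrite /S mevalD => Sg Sh; rewrite (_ : _ - _ =
    (g - (meval a g)%:A) + (h - (meval a h)%:A)); first exact: prop_idealD.
  by rewrite scalerDl; ring.
suff : S f by [].
rewrite [f]mpolyE; elim/big_ind: _ => [||m _]; first by rewrite -(scale0r 1).
  by [].
rewrite -mulr_algl; apply: (SM) => //; rewrite mpolyXE_id.
elim/big_ind: _ => [||i _]; first by rewrite -[1](scale1r 1).
  by [].
elim: (m i) => [|k IHk]; first by rewrite expr0 -[1](scale1r 1).
by rewrite exprS; apply: SM => //; rewrite /S mevalXU.
Qed.

(** Once the translates of all the variables have been adjoined, every polynomial
    is congruent to its value at a point.  A nonzero value in the ideal would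
    make it the unit ideal, and a zero value for p would put p in it. *)
Theorem nullstellensatz J p : prop_ideal J -> avoids_powers J p ->
  exists2 a : 'I_n -> K, (forall f, J f -> meval a f = 0) & meval a p != 0.
Proof.
move=> JI Jp; have [J' [J'I JJ' J'p J'X]] := adjoin_translates (enum 'I_n) JI Jp.
have [a Ja] : {a : 'I_n -> K & forall i, J' (mpolyX K (mnm1 i) - (a i)%:A)}.
  apply: (@boolp.choice _ _ (fun i b => J' (mpolyX K (mnm1 i) - b%:A))) => i.
  by apply: J'X; rewrite mem_enum.
exists a => [f Jf|].
  apply/eqP; apply: contrapT => /negP fa; apply: (J'p 0%N).
  have J'c : J' (meval a f)%:A.
    rewrite -[_%:A](subKr f); apply: prop_idealB => //; first exact: JJ'.
    exact: sub_meval_ideal.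
  have := prop_idealM (meval a f)^-1%:A J'I J'c.
  by rewrite mulr_algl scalerA mulVf // scale1r.
apply/eqP => pa; apply: (J'p 1%N).
by rewrite expr1 -[p]subr0 -(scale0r 1) -pa; exact: sub_meval_ideal.
Qed.

End Nullstellensatz.

(** * Chains of primes and the Krull dimension of a toric ring *)

(** The elements f 0, ..., f (d - 1), each picked in one step of the chain, are
    algebraically independent modulo P 0.  Take a relation modulo P j in which
    only f j, f (j + 1), ... occur.  Divide it by the largest possible power of
    f j, which is not in the prime P j; modulo P (j + 1) the terms that still
    contain f j vanish, and the terms of least exponent B' give a shorter
    relation in f (j + 1), ... *)
Lemma chain_independence (A : comNzRingType) (T : finType) (d : nat)
    (P : nat -> prime_idealr A) (f : nat -> A) (e : T -> nat -> nat) (c : T -> A) :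
  (forall i, (i < d)%N -> [/\ {subset P i <= P i.+1}, f i \notin P i & f i \in P i.+1]) ->
  forall (j : nat) (B : {set T}), (j <= d)%N -> B != finset.set0 ->
  {in B &, forall t u, (forall i, (j <= i < d)%N -> e t i = e u i) -> t = u} ->
  \sum_(t in B) c t * \prod_(j <= i < d) f i ^+ e t i \in P j ->
  exists2 t, t \in B & c t \in P d.
Proof.
move=> chain j B lejd; rewrite -(subKn lejd).
move: (leq_subr j d); move: (d - j)%N => {lejd} k.
(* The induction is on k, the number of elements f i that remain. *)
elim: k B => [|k IHk] B lekd /set0Pn[t0 Bt0] eB; set j' := (d - _)%N in eB *.
  rewrite /j' subn0 in eB *; rewrite (big_pred1 t0) => [|t].
    by rewrite big_geq // mulr1; exists t0.
  apply/idP/eqP => [Bt|->] //; apply: eB => // i.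
  by case/andP=> /leq_ltn_trans/[apply]; rewrite ltnn.
have ltj'd : (j' < d)%N by rewrite /j'; lia.
have [Psub fP fPS] := chain _ ltj'd.
have dkE : (d - k)%N = j'.+1 by rewrite /j'; lia.
pose m := e [arg min_(t < t0 | t \in B) e t j'] j'.
have em t : t \in B -> (m <= e t j')%N.
  by rewrite /m; case: arg_minnP => // t1 _ + Bt; apply.
pose B' := [set t in B | e t j' == m]%SET.
pose G t := c t * \prod_(j'.+1 <= i < d) f i ^+ e t i.
have -> : \sum_(t in B) c t * \prod_(j' <= i < d) f i ^+ e t i =
    f j' ^+ m * (\sum_(t in B') G t +
      f j' * \sum_(t in B | e t j' != m) f j' ^+ (e t j' - m.+1) * G t).
  rewrite (bigID (fun t => e t j' == m)) /= mulrDr !mulr_sumr; congr (_ + _).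
    apply: eq_big => [t|t /andP[_ /eqP etm]]; first by rewrite inE.
    by rewrite big_ltn // etm /G; ring.
  apply: eq_bigr => t /andP[/em lemt netm].
  have ltmt : (m < e t j')%N by rewrite ltn_neqAle eq_sym netm.
  rewrite big_ltn // /G -{1}(subnKC ltmt) exprD exprS; ring.
rewrite prime_idealrM => /orP[fm|].
  have /negP[] := fP; elim: (m) fm => [|m' IHm]; first by rewrite expr0 idealr1.
  by rewrite exprS prime_idealrM => /orP[].
move=> /Psub; rewrite rpredDr; last by rewrite mulrC idealMr.
move=> GP; have [||||t B't ct] := IHk B'.
- exact: ltnW.
- apply/set0Pn; exists [arg min_(t < t0 | t \in B) e t j']; rewrite inE.
  by rewrite eqxx andbT; case: arg_minnP.
- move=> t u; rewrite !inE => /andP[Bt /eqP et] /andP[Bu /eqP eu] etu.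
  apply: eB => // i /andP[]; rewrite leq_eqVlt => /orP[/eqP<- _|ltji ltid].
    by rewrite et eu.
  by apply: etu; rewrite dkE ltji.
- by rewrite dkE.
by exists t => //; move: B't; rewrite inE => /andP[].
Qed.


Lemma msizeM_le (K : idomainType) (n : nat) (p q : mpoly n K) (a b : nat) :
  (mmeasure mdeg p <= a.+1)%N -> (mmeasure mdeg q <= b.+1)%N ->
  (mmeasure mdeg (p * q) <= (a + b).+1)%N.
Proof.
have [->|p0] := eqVneq p 0; first by rewrite mul0r mmeasure0.
have [->|q0] := eqVneq q 0; first by rewrite mulr0 mmeasure0.
by rewrite msizeM // => pa qb; lia.
Qed.

Lemma msize_monomial_le (K : idomainType) (n m : nat) (F : 'I_m -> mpoly n K)
    (e : 'I_m -> nat) (D N : nat) :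
  (forall i, mmeasure mdeg (F i) <= D.+1)%N -> (forall i, e i <= N)%N ->
  (mmeasure mdeg (\prod_i F i ^+ e i)%R <= (m * (N * D)).+1)%N.
Proof.
move=> FD eN.
suff : (mmeasure mdeg (\prod_i F i ^+ e i)%R <= (\sum_(i < m) e i * D).+1)%N.
  move=> /leq_trans; apply; rewrite ltnS.
  apply: (@leq_trans (\sum_(i < m) N * D)); last by rewrite sum_nat_const card_ord.
  by apply: leq_sum => i _; rewrite leq_mul.
elim/big_ind2: _ => [|p a q b pa qb|i _]; first by rewrite mmeasure1.
  exact: msizeM_le.
elim: (e i) => [|k IHk]; first by rewrite expr0 mmeasure1.
by rewrite exprS mulSn; exact: msizeM_le.
Qed.

Definition box_code (B : nat) (z : int) : 'I_(2 * B).+1 := inord (absz (Posz B + z)).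

Lemma box_code_inj (B : nat) (y z : int) :
  (`|y| <= B)%N -> (`|z| <= B)%N -> box_code B y = box_code B z -> y = z.
Proof.
move=> yB zB /(congr1 val); rewrite /= !inordK; [lia|lia|lia].
Qed.

Section ToricCounting.
Variables (K : numFieldType) (r n : nat) (A : 'M[int]_(r, n)).

(** The exponent of the k-th torus coordinate in the image of the monomial with
    exponents m. *)
Definition weight (k : 'I_r) (m : 'I_n -> nat) : int := \sum_i A k i * (m i)%:Z.

Lemma weight_bound k m (D : nat) : (\sum_i m i <= D)%N ->
  (`|weight k m| <= (\sum_j \sum_i `|A j i|) * D)%N.
Proof.
move=> mD; rewrite -lez_nat abszE; apply: le_trans (ler_norm_sum _ _ _) _.
apply: (@le_trans _ _ (\sum_i (`|A k i| * m i)%N%:Z)).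
  by apply: ler_sum => i _; rewrite normrM -abszE PoszM.
rewrite -(big_morph Posz PoszD (erefl _)) lez_nat.
apply: (@leq_trans (\sum_i `|A k i| * D)%N).
  apply: leq_sum => i _; rewrite leq_mul // (leq_trans _ mD) //.
  by rewrite (bigD1 i) //= leq_addr.
by rewrite -big_distrl leq_mul // [leqRHS](bigD1 k) //= leq_addr.
Qed.

(** The weight is linear in m, with matrix A, and the other rows of A are
    combinations of the rows of a maximal independent subset. *)
Lemma weight_determined (m m' : 'I_n -> nat) :
  let f := maxrankfun (map_mx intr A : 'M[K]_(r, n)) in
  (forall k, weight (f k) m = weight (f k) m') -> forall k, weight k m = weight k m'.
Proof.
set AK := map_mx _ _ => f wf k.
pose v : 'cV[K]_n := \col_i ((m i)%:R - (m' i)%:R).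
have AKv j : (AK *m v) j 0 = (weight j m - weight j m')%:~R.
  rewrite mxE rmorphB /= /weight !rmorph_sum -sumrB; apply: eq_bigr => i _ /=.
  by rewrite !mxE mulrBr !rmorphM.
have fv : rowsub f AK *m v = 0.
  by rewrite mul_rowsub_mx; apply/colP => j; rewrite mxE AKv wf subrr mxE.
have /submxP[X AKE] : (AK <= rowsub f AK)%MS by rewrite eq_maxrowsub.
move: (AKv k); rewrite AKE -mulmxA fv mulmx0 mxE => /esym/eqP.
by rewrite intr_eq0 subr_eq0 => /eqP.
Qed.


Lemma monomial_weight (s : 'I_r -> K) (m : 'I_n -> nat) : (forall k, s k != 0) ->
  \prod_i (\prod_k s k ^ A k i) ^+ m i = \prod_k s k ^ weight k m.
Proof.
move=> s0; under eq_bigr do rewrite -prodrXl; rewrite exchange_big /=.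
apply: eq_bigr => k _; rewrite /weight.
rewrite (big_morph (fun z => s k ^ z) (fun x y => expfzDr x y (s0 k)) (expr0z _)).
by apply: eq_bigr => i _; rewrite exprnP exprz_exp.
Qed.

(** There are N^m monomials in the F i with exponents below N.  Let D bound the
    degrees of the F i, let L = m N D, and let M be the sum of the |A j i|.  The
    weights of the variables' monomials of degree at most L take at most
    (2 M L + 1)^d values, where d is the rank of A.  Since 2 M L + 1 <= C N with
    C = 2 M m D + 1, taking N = C^d + 1 makes (C N)^d < N^(d + 1) <= N^m, so some
    nontrivial combination of the N^m monomials has, for each weight, terms
    whose coefficients add up to zero. *)
Lemma toric_relation (m : nat) (F : 'I_m -> mpoly n K) :
  (\rank (map_mx intr A : 'M[K]_(r, n)) < m)%N ->
  exists (N : nat) (c : {ffun 'I_m -> 'I_N} -> K),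
    (exists t, c t != 0) /\
    forall s : 'I_r -> K, (forall k, s k != 0) ->
      meval (fun i => \prod_k s k ^ A k i)
        (\sum_t c t *: \prod_i F i ^+ (t i)) = 0.
Proof.
set d := \rank _ => ltdm; pose f := maxrankfun (map_mx intr A : 'M[K]_(r, n)).
pose D := \max_i mmeasure mdeg (F i).
have FD i : (mmeasure mdeg (F i) <= D.+1)%N by rewrite ltnW // ltnS leq_bigmax.
pose M := (\sum_j \sum_i `|A j i|)%N.
pose N := ((2 * (M * (m * D))).+1 ^ d).+1.
pose L := (m * (N * D))%N.
pose U : finType := {ffun 'I_d -> 'I_(2 * (M * L)).+1}.
pose code (q : bmultinom n L.+1) : U :=
  [ffun k => box_code (M * L) (weight (f k) q)].
have weight_le k (q : bmultinom n L.+1) : (`|weight k q| <= M * L)%N.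
  by apply: weight_bound; rewrite -mdegE -ltnS; case: q.
have code_inj q q' : code q = code q' -> forall k, weight k q = weight k q'.
  move=> qq'; apply: weight_determined => k.
  move/ffunP: qq' => /(_ k); rewrite !ffunE.
  by apply: box_code_inj; exact: weight_le.
pose G (t : {ffun 'I_m -> 'I_N}) := \prod_i F i ^+ (t i).
have GE t : G t = \sum_(q : bmultinom n L.+1) mcoeff q (G t) *: mpolyX K q.
  apply: mpolywE; apply: msize_monomial_le => // i; exact: ltnW.
have [|c c0 crel] := @nontrivial_relation K {ffun 'I_m -> 'I_N} U
    (fun t u => \sum_(q | code q == u) mcoeff q (G t)).
  have leqX a b e : (a <= b -> a ^ e <= b ^ e)%N.
    by case: e => // e ab; rewrite leq_exp2r.
  rewrite !card_ffun !card_ord.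
  apply: (@leq_ltn_trans (((2 * (M * (m * D))).+1 * N) ^ d)%N).
    by apply: leqX; nia.
  rewrite expnMn; apply: (@leq_trans (N ^ d.+1)%N).
    by rewrite expnS ltn_mul2r expn_gt0 /= ltnSn.
  by apply: leq_pexp2l.
exists N, c; split=> // s s0.
under eq_bigr do rewrite -/(G _) GE scaler_sumr.
rewrite exchange_big raddf_sum /=.
under eq_bigr do (under eq_bigr do rewrite scalerA; 
  rewrite -scaler_suml mevalZ mevalX monomial_weight //).
rewrite (partition_big code predT) //= big1 // => u _.
have [q0 /eqP q0u|nou] := pickP (fun q => code q == u); last by rewrite big_pred0.
transitivity (\sum_(q | code q == u) (\sum_t c t * mcoeff q (G t)) *
    \prod_k s k ^ weight k q0).
  apply: eq_bigr => q /eqP qu; congr (_ * _); apply: eq_bigr => k _.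
  by rewrite (code_inj q q0) // qu.
rewrite -mulr_suml exchange_big /=.
by under eq_bigr do rewrite -mulr_sumr; rewrite crel mul0r.
Qed.

End ToricCounting.

(** The relation between the representatives of the f i vanishes on the torus,
    hence is in I, and would make some nonzero scalar an element of a proper
    ideal. *)
Lemma chain_length_le_rank (K : numFieldType) (r n : nat) (A : 'M[int]_(r, n))
    (I : prime_idealr (mpoly n K)) :
  (forall p, (forall s : 'I_r -> K, (forall k, s k != 0) ->
      meval (fun i => \prod_k s k ^ A k i) p = 0) -> p \in I) ->
  forall (d : nat) (P : 'I_d.+1 -> prime_idealr {ideal_quot I}),
    strict_chain P -> (d <= \rank (map_mx intr A : 'M[K]_(r, n)))%N.
Proof.
move=> IA d P Pchain; rewrite leqNgt; apply/negP => ltAd.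
pose Q i := P (inord i).
have {Pchain} Qchain i : (i < d)%N ->
    exists f, [/\ {subset Q i <= Q i.+1}, f \notin Q i & f \in Q i.+1].
  move=> ltid; have [|sub nsub] := Pchain (inord i) (inord i.+1).
    by rewrite !inordK // ltnS // ltnW.
  move/existsNP: nsub => [f /not_implyP[fS /negP fi]]; by exists f; split.
have [f Hf] : {f : nat -> {ideal_quot I} & forall i, (i < d)%N ->
    [/\ {subset Q i <= Q i.+1}, f i \notin Q i & f i \in Q i.+1]}.
  apply: (@boolp.choice _ _ (fun i f => (i < d)%N ->
    [/\ {subset Q i <= Q i.+1}, f \notin Q i & f \in Q i.+1])) => i.
  by have [/Qchain[f]|_] := ltnP i d; [exists f|exists 0].
have [N [c [[t0 ct0] crel]]] :=
  toric_relation (fun i : 'I_d => repr (f i)) ltAd.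
pose pi : {rmorphism mpoly n K -> {ideal_quot I}} := \pi%qT.
pose B := [set t | c t != 0]%SET.
pose e (t : {ffun 'I_d -> 'I_N}) (i : nat) : nat :=
  if insub i is Some i' then t i' else 0%N.
have eE t (i : 'I_d) : e t i = t i by rewrite /e valK.
have relE : \sum_(t in B) pi (c t)%:A * \prod_(0 <= i < d) f i ^+ e t i = 0.
  transitivity (pi (\sum_t c t *: \prod_(i < d) repr (f i) ^+ t i)).
    rewrite rmorph_sum [RHS](bigID (mem B)) /= [X in _ = _ + X]big1 => [|t].
      rewrite addr0; apply: eq_bigr => t _.
      rewrite -[X in _ = pi X]mulr_algl rmorphM rmorph_prod big_mkord; congr (_ * _).
      by apply: eq_bigr => i _; rewrite rmorphXn /= reprK eE.
    by rewrite inE negbK => /eqP ->; rewrite scale0r rmorph0.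
  have := IA _ crel; rewrite -(subr0 (\sum_t _)) Quotient.idealrBE => /eqP.
  by rewrite subr0 => relI; exact: etrans relI (rmorph0 pi).
have [||||t] := @chain_independence _ _ d Q f e (fun t => pi (c t)%:A) Hf 0%N B.
- by [].
- by apply/set0Pn; exists t0; rewrite inE.
- move=> t u _ _ etu; apply/ffunP => i; apply: val_inj.
  by rewrite /= -!eE; apply: etu => /=.
- by rewrite relE rpred0.
rewrite inE => ct0' /(idealMr (pi (c t)^-1%:A)).
by rewrite -rmorphM mulr_algl scalerA mulVf // scale1r rmorph1 idealr1.
Qed.

(** * Diagonal symmetries of a toric ideal *)

Section DiagonalExponential.
Variables (R : realType) (n : nat).
Local Notation C := R[i].

Lemma diag_mxX (d : 'rV[C]_n) k : diag_mx d ^+ k = diag_mx (\row_i d 0 i ^+ k).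
Proof.
elim: k => [|k IHk].
  rewrite expr0; apply/matrixP => i j; rewrite !mxE.
  by rewrite expr0.
rewrite exprS IHk -mulmxE mulmx_diag; congr diag_mx.
by apply/rowP => i; rewrite !mxE exprS.
Qed.

Lemma cvg_series_exp_complex (x : R) (e : C) : 0 < e ->
  \forall N \near \oo, `|(expR x)%:C - (series (exp_coeff x) N)%:C| < e.
Proof.
case: e => a b; rewrite ltcE /= => /andP[/eqP -> a0].
have /cvgrPdist_lt/(_ a a0) := is_cvg_series_exp_coeff x.
apply: filterS => N; rewrite -rmorphB /= normc_def /= expr0n addr0 sqrtr_sqr.
by rewrite ltcE /= eqxx.
Qed.

Lemma expmx_diag (w : 'I_n -> R) :
  expmx (diag_mx (\row_i (w i)%:C)) = diag_mx (\row_i (expR (w i))%:C).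
Proof.
apply: (@cvg_lim 'M[C^o]_n (@norm_hausdorff C 'M[C^o]_n)).
apply/cvg_ballP => e e0.
have : \forall N \near \oo, forall i : 'I_n,
   `|(expR (w i))%:C - (series (exp_coeff (w i)) N)%:C| < e.
  by apply: filter_forall => i; exact: cvg_series_exp_complex.
apply: filterS => N HN; split => // i j.
rewrite (_ : \sum_(0 <= k < N) _ = diag_mx (\row_i (series (exp_coeff (w i)) N)%:C)).
  rewrite !mxE; case: (i == j); rewrite ?mulr1n ?mulr0n; first exact: HN.
  by rewrite /ball /= subr0 normr0.
apply/matrixP => k l; rewrite summxE !mxE raddf_sum /= -sumrMnl.
apply: eq_bigr => q _; rewrite diag_mxX !mxE mulrnAr; congr (_ *+ _).
by rewrite /exp_coeff /= rmorphM rmorphXn /= mulrC fmorphV rmorph_nat.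
Qed.

End DiagonalExponential.

Section ToricSymmetries.
Variables (R : realType) (r n : nat) (A : 'M[int]_(r, n)).
Local Notation C := R[i].
Implicit Types (I : prime_idealr (mpoly n C)).

Lemma peval_torus_map (s : 'cV[C]_r) p :
  peval (torus_map A s) p = meval (fun i => \prod_k s k 0 ^ A k i) p.
Proof. by apply: meval_eq => i; rewrite mxE. Qed.

(** An ideal is not determined by its zeros, but a prime one is: a polynomial
    outside I has all its powers outside I. *)
Lemma toric_idealP I p :
  zeros [set` I] = zariski_closure (torus_map A @` @torus R r) ->
  p \in I <-> forall s, torus s -> peval (torus_map A s) p = 0.
Proof.
move=> VI; split=> [pI s s0|pA].
  have : zeros [set` I] (torus_map A s).
    by rewrite VI; apply: sub_gen_smallest; exists s.
  exact.
apply: contrapT => pI.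
have [||a Ia /eqP[]] := @nullstellensatz _ n (@uncountable_complex R) [set` I] p.
- split=> /= [|a u v uI vI]; first exact: rpred0.
  by rewrite rpredD // idealMr.
- elim=> [|k IHk] /=; first by rewrite expr0 idealr1.
  by rewrite exprS prime_idealrM => /orP[].
have : zeros [set p] (\col_i a i).
  have : zeros [set` I] (\col_i a i).
    by move=> f /Ia <-; apply: meval_eq => i; rewrite mxE.
  rewrite VI; apply: smallest_sub; first by exists [set p].
  by move=> _ [s s0 <-] q ->; exact: pA.
by move=> /(_ p erefl) <-; apply: meval_eq => i; rewrite mxE.
Qed.

Lemma invmx_diag (x : 'I_n -> C) : (forall i, x i != 0) ->
  diag_mx (\row_i x i) \in unitmx /\
  invmx (diag_mx (\row_i x i)) = diag_mx (\row_i (x i)^-1).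
Proof.
move=> x0; have xV : diag_mx (\row_i (x i)^-1) *m diag_mx (\row_i x i) = 1%:M.
  rewrite mulmx_diag; apply/matrixP => i j; rewrite !mxE mulVf //.
have xU := (mulmx1_unit xV).2; split=> //.
by rewrite -[LHS]mul1mx -xV mulmxK.
Qed.

(** The diagonal matrix acts on the image of the torus as the multiplication of
    the k-th torus coordinate by z. *)
Lemma torus_symmetry I (k : 'I_r) (z : C) :
  zeros [set` I] = zariski_closure (torus_map A @` @torus R r) -> z != 0 ->
  symmetry_group I (diag_mx (\row_i z ^ A k i)).
Proof.
move=> VI z0; have [zU zV] := invmx_diag (fun i => expfz_neq0 (A k i) z0).
split=> // p /(toric_idealP _ VI) pA; apply/(toric_idealP _ VI) => s s0.
pose s' := \col_j (if j == k then z^-1 * s j 0 else s j 0) : 'cV[C]_r.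
rewrite peval_gl_act (_ : invmx _ *m _ = torus_map A s').
  apply: pA => j; rewrite mxE; case: (j =P k) => _; last exact: s0.
  by rewrite mulf_neq0 ?invr_eq0 //; exact: s0.
apply/colP => i; rewrite zV mul_diag_mx !mxE [RHS](bigD1 k) //= (bigD1 k) //=.
rewrite mxE eqxx expfzMl exprz_inv invr_expz mulrA; congr (_ * _).
by apply: eq_bigr => j jk; rewrite mxE (negPf jk).
Qed.

Lemma row_symmetry_algebra I (k : 'I_r) :
  zeros [set` I] = zariski_closure (torus_map A @` @torus R r) ->
  symmetry_algebra I (diag_mx (row k (map_mx intr A))).
Proof.
move=> VI t.
have -> : t%:C *: diag_mx (row k (map_mx intr A)) =
    diag_mx (\row_i (t * (A k i)%:~R)%:C).
  rewrite -linearZ; congr diag_mx; apply/rowP => i.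
  by rewrite !mxE rmorphM rmorph_int.
rewrite expmx_diag.
have -> : \row_i (expR (t * (A k i)%:~R))%:C = \row_i (expR t)%:C ^ A k i.
  apply/rowP => i; rewrite !mxE; case: (A k i) => m.
    by rewrite expRM_natr rmorphXn.
  by rewrite NegzE mulrNz mulrN expRN expRM_natr fmorphV rmorphXn.
by apply: torus_symmetry => //; rewrite fmorph_eq0 gt_eqF ?expR_gt0.
Qed.

Lemma rank_le_linear_dim I :
  zeros [set` I] = zariski_closure (torus_map A @` @torus R r) ->
  (\rank (map_mx intr A : 'M[C]_(r, n)) <= linear_dim (symmetry_algebra I))%N.
Proof.
move=> VI; set AK := map_mx _ _; set d := \rank AK.
pose X := [tuple diag_mx (row (maxrankfun AK i) AK) | i < d].
have Xfree : free X.
  apply/freeP => k; under eq_bigr do rewrite -tnth_nth tnth_mktuple -linearZ_LR.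
  rewrite -linear_sum /= => kX i.
  have : \row_j k j *m rowsub (maxrankfun AK) AK = 0.
    apply/rowP => j; move/matrixP: kX => /(_ j j).
    rewrite !mxE eqxx mulr1n summxE => kXj.
    by apply: etrans kXj; apply: eq_bigr => l _; rewrite !mxE.
  rewrite -[RHS](mul0mx _ (rowsub (maxrankfun AK) AK)).
  by move=> /(row_free_inj (maxrowsub_free AK))/rowP/(_ i); rewrite !mxE.
have dX : (d < (\dim {:'M[C]_n}).+1)%N.
  by rewrite ltnS -[d](size_tuple X) -(eqP Xfree) dimvS // subvf.
apply: (@leq_bigmax_cond _ _ (fun k : 'I__ => k : nat) (Ordinal dX)).
apply/asboolP; exists X; split => // v /tnthP[i ->].
by rewrite tnth_mktuple; exact: row_symmetry_algebra.
Qed.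

End ToricSymmetries.

(** The rank of A separates the two dimensions. *)
Theorem theorem23 (R : realType) (n : nat) (I : prime_idealr (mpoly n R[i])) :
  homogeneous_ideal I ->
  ((linear_dim (symmetry_algebra I))%:R%:E < krull_dim R {ideal_quot I})%E ->
  ~ toric_variety (zeros [set` I]).
Proof.
move=> _ + [r [A VI]]; apply/negP; rewrite -leNgt.
apply: ge_ereal_sup => _ [d [P Pchain] <-]; rewrite lee_fin ler_nat.
apply: leq_trans (rank_le_linear_dim VI).
apply: chain_length_le_rank Pchain => p pA; apply/(toric_idealP _ VI) => s s0.
by rewrite peval_torus_map; exact: pA.
Qed.
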